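(* Every representation of $100$ is universal. Moreover, for any representation of $100$ as $\frac{p(3)}{q(3)}$ with $p(x),q(x)\in\mathcal P$, the quotient $\frac{p(x)}{q(x)}$ is $x^4+x^3-x^2+1$.
   Context: $\mathcal P$ denotes the set of Newman polynomials, i.e. polynomials with all coefficients in $\{0,1\}$ and constant term $1$ (including the constant polynomial $1$). A representation of an integer $m\equiv 1\pmod 3$ is an expression $m=\frac{p(3)}{q(3)}$ with $p(x),q(x)\in\mathcal P$. The representation is universal if $q(x)\mid p(x)$ (as polynomials), and local if $q(x)\nmid p(x)$. *)

(* Defs.v *)
From mathcomp Require Import all_boot all_order all_algebra.

Set Implicit Arguments.
Unset Strict Implicit.
Unset Printing Implicit Defensive.

Import GRing.Theory.
Local Open Scope ring_scope.

(* Polynomials live in Q[x], so that %| and %/ are the field versions. A Newman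
   polynomial is monic, hence divisibility of Newman polynomials is the same
   over Q and over Z. *)
Definition newman (p : {poly rat}) : Prop :=
  (forall i : nat, p`_i = 0 \/ p`_i = 1) /\ p`_0 = 1.

(* The division is genuine: q(3) >= 1 for a Newman polynomial q. The condition
   m = 1 mod 3 is not required since it follows from p(3) = q(3) = 1 mod 3. *)
Definition representation (m : int) (p q : {poly rat}) : Prop :=
  [/\ newman p, newman q & m%:~R = p.[3] / q.[3]].

Definition universal (p q : {poly rat}) : Prop := q %| p.

(* Main.v *)
Require Import Defs.
From mathcomp Require Import all_boot all_order all_algebra.
From mathcomp Require Import zify ring.

Set Implicit Arguments.
Unset Strict Implicit.
Unset Printing Implicit Defensive.

Import GRing.Theory.
Local Open Scope ring_scope.

(** Multiply [q(3)] by [100] digit by digit in base 3: with [a_i], [b_i] the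
    coefficients of [p], [q], the carries satisfy
    [3 c_(i+1) = c_i + 100 b_i - a_i], [c_0 = 0], and vanish eventually.
    Put [r = x^4 + x^3 - x^2 + 1]. Since
    [r - 100 = (x - 3) (x^3 + 4 x^2 + 11 x + 33)], we have [p = r q] as long as
    [c_i = 33 b_(i-1) + 11 b_(i-2) + 4 b_(i-3) + b_(i-4)]. When this holds up to
    [i], the digit [a_i] is congruent mod 3 to
    [b_i - b_(i-2) + b_(i-3) + b_(i-4)], which lies between -1 and 3, so it is
    equal to it unless that value is 3. In the latter case [c_(i+1)] is 35 or
    46, from which the carry can never come back to 0. *)

(** All carries reachable from 35 or 46; 0 is not among them. *)
Definition trap_carries : seq int := [:: 5; 15; 16; 35; 38; 45; 46; 48; 49].

Lemma third_eq (c k : int) : 3 * c = k -> (3 %| k)%Z /\ c = (k %/ 3)%Z.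
Proof. by move<-; rewrite dvdz_mulr // mulKz. Qed.

Lemma trap_carries_step (a b : bool) (c c' : int) :
  3 * c' = c + 100 * b%:Z - a%:Z -> c \in trap_carries -> c' \in trap_carries.
Proof.
have /allP trapP : all (fun d : int => all (fun b : bool => all (fun a : bool =>
    let k := d + 100 * b%:Z - a%:Z in
    (3 %| k)%Z ==> ((k %/ 3)%Z \in trap_carries))
    [:: false; true]) [:: false; true]) trap_carries by vm_compute.
have bool_mem (d : bool) : d \in [:: false; true] by case: d.
move=> /third_eq[k3 ->] /trapP/allP/(_ b (bool_mem b))/allP/(_ a (bool_mem a)).
by move/implyP; apply.
Qed.

Lemma carry_trapped (a b : nat -> bool) (c : nat -> int) (i n : nat) :
  (forall j, 3 * c j.+1 = c j + 100 * (b j)%:Z - (a j)%:Z) ->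
  c i \in trap_carries -> c (i + n)%N \in trap_carries.
Proof.
move=> step c_trap; elim: n => [|n IHn]; first by rewrite addn0.
by rewrite addnS; apply: trap_carries_step (step _) IHn.
Qed.

Lemma carry_step (a b0 b1 b2 b3 b4 : bool) (c' : int) :
  3 * c' = (33 * b3%:Z + 11 * b2%:Z + 4 * b1%:Z + b0%:Z) + 100 * b4%:Z - a%:Z ->
  c' \notin trap_carries ->
  c' = 33 * b4%:Z + 11 * b3%:Z + 4 * b2%:Z + b1%:Z /\
  a%:Z = b4%:Z - b2%:Z + b1%:Z + b0%:Z.
Proof.
move/third_eq=> [K3 ->].
(* [K3] excludes the values -1 and 2 of the digit expression; the value 3 leads into the trap. *)
case: a b0 b1 b2 b3 b4 K3 => [] [] [] [] [] []; vm_compute => //.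
Qed.

(* [b] is delayed by four places so that the four digits preceding the first
   one are available as zeros. *)
Lemma digits_mul100 (a b : nat -> bool) (c : nat -> int) (N : nat) :
  (forall i, (i < 4)%N -> b i = false) ->
  (forall i, 3 * c i.+1 = c i + 100 * (b i.+4)%:Z - (a i)%:Z) ->
  c 0 = 0 -> (forall i, (N <= i)%N -> c i = 0) ->
  forall i, (a i)%:Z = (b i.+4)%:Z - (b i.+2)%:Z + (b i.+1)%:Z + (b i)%:Z.
Proof.
move=> b_lt4 step c0 cN.
(* Otherwise [c (i + N)], which is 0, would be trapped. *)
have not_trapped i : c i \notin trap_carries.
  by apply/negP => /(carry_trapped N step); rewrite cN // leq_addl.
have cE i : c i = 33 * (b i.+3)%:Z + 11 * (b i.+2)%:Z + 4 * (b i.+1)%:Z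
                  + (b i)%:Z.
  elim: i => [|i IHi]; first by rewrite c0 !b_lt4.
  by have := step i; rewrite IHi => /carry_step/(_ (not_trapped _)) [].
by move=> i; have := step i; rewrite (cE i) => /carry_step/(_ (not_trapped _)) [].
Qed.

Lemma horner_drop_poly (R : comNzRingType) (p : {poly R}) (x : R) (i : nat) :
  (drop_poly i p).[x] = p`_i + x * (drop_poly i.+1 p).[x].
Proof.
have ->: drop_poly i p = (p`_i)%:P + 'X * drop_poly i.+1 p.
  apply/polyP => -[|j]; rewrite coefD coefC coefXM !coef_drop_poly /=.
    by rewrite addr0.
  by rewrite add0r addnS addSn.
by rewrite !hornerE.
Qed.

Lemma newman_coef (p : {poly rat}) (i : nat) :
  newman p -> p`_i = (p`_i == 1)%:R.
Proof. by case=> /(_ i)[]->. Qed.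

(** Lifting to integer coefficients makes the carries integers, so that congruences mod 3 apply. *)
Lemma newman_map_intr (p : {poly rat}) :
  newman p -> exists P : {poly int},
    p = map_poly intr P /\ forall i, P`_i = (p`_i == 1)%:Z.
Proof.
move=> newp; pose P := \poly_(i < size p) ((p`_i == 1)%:Z).
have PE i : P`_i = (p`_i == 1)%:Z.
  by rewrite coef_poly; case: ltnP => // le_p_i; rewrite nth_default.
exists P; split=> //; apply/polyP => i.
by rewrite coef_map /= PE {1}newman_coef.
Qed.

Lemma newman_neq0 (p : {poly rat}) : newman p -> p != 0.
Proof. by case=> _ p0; apply/eqP => p_eq0; move: p0; rewrite p_eq0 coef0. Qed.

(** The constant term 1 makes the value congruent to 1 mod 3. *)
Lemma newman_horner3_neq0 (p : {poly rat}) : newman p -> p.[3] != 0.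
Proof.
move=> newp; have [P [defp PE]] := newman_map_intr newp.
rewrite {1}defp; have ->: 3 = 3%:~R :> rat by [].
rewrite horner_map intr_eq0; have := horner_drop_poly P 3 0.
rewrite drop_poly0l => ->; rewrite PE.
by case: newp => _ ->; rewrite eqxx; lia.
Qed.

Lemma representation100_eq (p q : {poly rat}) :
  representation 100 p q -> p = ('X^4 + 'X^3 - 'X^2 + 1) * q.
Proof.
move=> [newp newq pq100].
have [P [defp PE]] := newman_map_intr newp.
have [Q [defq QE]] := newman_map_intr newq.
pose F := P - 100%:P * Q.
have F3 : F.[3] = 0.
  have pE : p.[3] = 100 * q.[3].
    by rewrite -[100]/(100%:~R) pq100 (divfK (newman_horner3_neq0 newq)).
  apply/eqP; rewrite -(intr_eq0 rat) /F !hornerE rmorphB rmorphM /=.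
  by rewrite -!(horner_map intr) -defp -defq /= pE subrr.
(* Since [F.[3] = 0], this is also minus the value at 3 of the part of [F] below degree i, divided
   by 3^i: the usual carry. Taken from the high part, it is visibly an integer and vanishes for
   large i. *)
pose c i : int := (drop_poly i F).[3].
pose b i := (4 <= i)%N && (q`_(i - 4) == 1).
have step i : 3 * c i.+1 = c i + 100 * (b i.+4)%:Z - (p`_i == 1)%:Z.
  rewrite /b /= subSS subSS subSS subSS subn0 -PE -QE.
  by rewrite /c (horner_drop_poly F 3 i) /F coefB coefCM; ring.
have b_lt4 i : (i < 4)%N -> b i = false by rewrite /b ltnNge => /negbTE ->.
have c0 : c 0 = 0 by rewrite /c drop_poly0l.
have cN i : (size F <= i)%N -> c i = 0.
  by move=> le_F_i; rewrite /c (drop_poly_eq0 le_F_i) horner0.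
have digits := digits_mul100 (a := fun i => p`_i == 1) b_lt4 step c0 cN.
have bE i : (b i)%:Z%:~R = ('X^4 * q)`_i.
  rewrite -pmulrn coefXnM /b leqNgt; case: ltnP => _; first exact: mulr0n.
  by rewrite andTb -(newman_coef _ newq).
apply/polyP => i; rewrite (newman_coef i newp).
rewrite pmulrn digits !(rmorphD, rmorphN) /= !bE.
rewrite !mulrDl mulNr mul1r !coefD coefN !coefXnM.
(* For i < 4 some of the shifted indices fall below 0 and contribute nothing. *)
by case: i => [|[|[|[|i]]]]; rewrite /= ?subSS ?subn0; ring.
Qed.

Theorem theorem2p6 :
  (forall p q : {poly rat}, representation 100 p q -> universal p q) /\
  (forall p q : {poly rat}, representation 100 p q ->
     p %/ q = 'X^4 + 'X^3 - 'X^2 + 1).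
Proof.
split=> p q rep; first by rewrite /universal (representation100_eq rep) dvdp_mull.
by rewrite {1}(representation100_eq rep) mulpK // newman_neq0 //; case: rep.
Qed.
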